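(* For every real $r>1$, the function $f:[0,\infty)\to\mathbb{R}$, $f(x)=x^r$, belongs to the class $\mathcal{W}$.
   Context: $\mathcal{W}$ denotes the class of all functions $f:[0,\infty)\to\mathbb{R}$ such that $f(x)-f(y)\ge f(x-y)$ for all $x\ge y\ge 0$; equivalently, $f(x+y)\ge f(x)+f(y)$ for all $x\ge y\ge 0$. *)

(* Defs.v *)
From mathcomp Require Import all_boot all_order all_algebra.
From mathcomp Require Import all_classical all_reals all_analysis.

Set Implicit Arguments.
Unset Strict Implicit.
Unset Printing Implicit Defensive.

Import Order.TTheory GRing.Theory Num.Theory.

Local Open Scope classical_set_scope.
Local Open Scope ring_scope.

(* A function [0, +oo[ -> R is represented by a total function R -> R whose
   values at negative arguments are irrelevant: only x, y and x - y, all of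
   them nonnegative, are used as arguments below. *)
Definition classW (R : realType) : set (R -> R) :=
  [set f | forall x y : R, 0 <= y -> y <= x -> f (x - y) <= f x - f y].

(* Main.v *)
Require Import Defs.
From mathcomp Require Import all_boot all_order all_algebra.
From mathcomp Require Import all_classical all_reals all_analysis.
Import Order.TTheory GRing.Theory Num.Theory.

(** Split off one factor of the power: for [u, v >= 0],
    [(u + v)^r = u (u + v)^(r - 1) + v (u + v)^(r - 1)], and since the exponent
    [r - 1] is nonnegative, replacing the base [u + v] by [u] in the first
    summand and by [v] in the second can only decrease the sum, to [u^r + v^r].
    The class inequality is this superadditivity with [u = x - y], [v = y]. *)

Local Open Scope ring_scope.

Lemma powR_superadditive (R : realType) (r u v : R) :
  1 <= r -> 0 <= u -> 0 <= v -> u `^ r + v `^ r <= (u + v) `^ r.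
Proof.
move=> r1 u0 v0.
have r0 : 0 < r by exact: lt_le_trans r1.
have uv0 : 0 <= u + v by exact: addr_ge0.
rewrite -(mulr_powRB1 u0 r0) -(mulr_powRB1 v0 r0) -(mulr_powRB1 uv0 r0) mulrDl.
by apply: lerD; apply: ler_wpM2l => //; apply: ge0_ler_powR;
  rewrite ?subr_ge0 ?nnegrE ?lerDl ?lerDr.
Qed.

Theorem theorem2p2 (R : realType) (r : R) (hr : 1 < r) :
  @classW R (fun x : R => x `^ r).
Proof.
move=> x y y0 yx /=.
rewrite lerBrDr -[in leRHS](subrK y x).
by apply: powR_superadditive; rewrite ?subr_ge0 // ltW.
Qed.
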